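(* Let $I=(\tau,\infty)$ with $\tau\in\{-\infty\}\cup\mathbb{R}$, let $B:I\to\mathbb{R}^{d\times d}$ be continuous, and consider the linear nonautonomous differential equation $\dot x = B(t)x$ with transition operator $\Phi:I\times I\to\mathbb{R}^{d\times d}$. Suppose that, for some $m\ge 1$ and positive integers $d_1,\dots,d_m$ with $\sum_{i=1}^m d_i=d$, the function $B$ has the lower block triangular form $$B(t)=\begin{pmatrix} B_{11}(t)&0&0&\cdots&0\\ B_{21}(t)&B_{22}(t)&0&\cdots&0\\ B_{31}(t)&B_{32}(t)&B_{33}(t)&\cdots&0\\ \vdots&\vdots&\vdots&\ddots&\vdots\\ B_{m1}(t)&B_{m2}(t)&B_{m3}(t)&\cdots&B_{mm}(t)\end{pmatrix}$$ for all $t\in I$, with bounded functions $B_{ij}:I\to\mathbb{R}^{d_i\times d_j}$. Assume that there exists $\delta>0$ such that for every $n\in\{1,\dots,m\}$: (i) $(B_{nn}(t))_{ii}<0$ for all $t\in I$ and $i\in\{1,\dots,d_n\}$; (ii) $(B_{nn}(t))_{ij}\ge 0$ for all $t\in I$ and $i\ne j\in\{1,\dots,d_n\}$; (iii) $\sum_{j=1}^{d_n}(B_{nn}(t))_{ij}\le-\delta$ for all $t\in I$ and $i\in\{1,\dots,d_n\}$. Then the linear system $\dot x=B(t)x$ is exponentially stable, i.e. there exist constants $K\ge 1$ and $\gamma>0$ such that $$\|\Phi(t,t_0)\|\le K e^{-\gamma(t-t_0)}\quad\text{for all } t\ge t_0>\tau.$$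
   Context: The transition operator $\Phi:I\times I\to\mathbb{R}^{d\times d}$ of $\dot x=B(t)x$ is defined by requiring that, for all $t_0\in I$ and $x_0\in\mathbb{R}^d$, the function $t\mapsto\Phi(t,t_0)x_0$ is the solution of $\dot x=B(t)x$ with $x(t_0)=x_0$. $\|\cdot\|$ is a matrix norm on $\mathbb{R}^{d\times d}$. *)

(* Defs.v *)
From HB Require Import structures.
From mathcomp Require Import all_boot all_order all_algebra.
From mathcomp Require Import all_classical all_reals all_analysis.

Set Implicit Arguments.
Unset Strict Implicit.
Unset Printing Implicit Defensive.

Import Order.TTheory GRing.Theory Num.Theory.
Import numFieldNormedType.Exports.

Local Open Scope classical_set_scope.
Local Open Scope ring_scope.

(* [tau = -oo] gives the whole line; users should assume [tau < +oo]. *)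
Definition open_ray (R : realType) (tau : \bar R) : set R :=
  [set t | (tau < t%:E)%E].

(* Any norm on the vector space of square matrices; submultiplicativity is
   not required. *)
Record is_matrix_norm (R : realType) (d : nat) (N : 'M[R]_d -> R) : Prop :=
  IsMatrixNorm {
    matrix_norm_eq0 : forall A, N A = 0 -> A = 0;
    matrix_normZ : forall (c : R) A, N (c *: A) = `|c| * N A;
    matrix_normD : forall A A', N (A + A') <= N A + N A' }.

(* Functions on [I] are represented by functions on [R] whose values outside
   [I] are irrelevant; this is harmless for derivatives when [I] is open. *)
Definition solves_ivp (R : realType) (d : nat) (I : set R)
    (B : R -> 'M[R]_d) (t0 : R) (x0 : 'cV[R]_d) (x : R -> 'cV[R]_d) : Prop :=
  (forall t, I t -> is_derive t (1 : R) x (B t *m x t)) /\ x t0 = x0.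

Definition is_transition_operator (R : realType) (d : nat) (I : set R)
    (B : R -> 'M[R]_d) (Phi : R -> R -> 'M[R]_d) : Prop :=
  forall (t0 : R) (x0 : 'cV[R]_d), I t0 ->
    solves_ivp I B t0 x0 (fun t => Phi t t0 *m x0).

Definition exponentially_stable (R : realType) (d : nat) (I : set R)
    (N : 'M[R]_d -> R) (Phi : R -> R -> 'M[R]_d) : Prop :=
  exists K gamma : R, [/\ 1 <= K, 0 < gamma &
    forall t t0 : R, I t0 -> t0 <= t ->
      N (Phi t t0) <= K * expR (- gamma * (t - t0))].

(* Main.v *)
(* In the sup norm with weights growing geometrically along the blocks, the
   blocks below the diagonal cost at most half of [delta], so every row of
   [B t] is diagonally dominant with margin [delta / 2], uniformly in [t].  Hence
   this norm of a solution, multiplied by a growing exponential of rate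
   [delta / 4], never exceeds its initial value. *)
Require Import Defs.
From HB Require Import structures.
From mathcomp Require Import all_boot all_order all_algebra.
From mathcomp Require Import all_classical all_reals all_analysis.
From mathcomp Require Import ring lra.
Set Implicit Arguments.
Unset Strict Implicit.
Unset Printing Implicit Defensive.
Import Order.TTheory GRing.Theory Num.Theory.
Import numFieldNormedType.Exports.
Local Open Scope classical_set_scope.
Local Open Scope ring_scope.

(** For small increments the difference quotient is negative, so a small step backwards raises the
    value. Looking only to the left also covers a maximum at the right end of an interval. *)
Lemma is_derive_lt0_left (R : realType) (f : R -> R) (x df a : R) :
  is_derive x (1 : R) f df -> df < 0 -> a < x ->
  exists2 y, a <= y <= x & f x < f y.
Proof.
move=> fx df0 ax.
have H : (h^-1 *: ((f \o shift x) (h *: 1) - f x)) @[h --> 0^'] --> df.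
  rewrite -(derive_val (is_derive := fx)); exact: (ex_derive (is_derive := fx)).
have [e /= e0 He] := cvgr_lt _ H _ df0.
(* The first bound keeps the step where the quotient is negative, the second keeps [x - h] at or
   above [a]. *)
pose h := Num.min (e / 2) (x - a).
have h0 : 0 < h by rewrite lt_min divr_gt0//= subr_gt0.
have hx : h <= x - a by rewrite ge_min lexx orbT.
have he : h < e.
  by rewrite (@le_lt_trans _ _ (e / 2)) ?ge_min ?lexx// ltr_pdivrMr// ltr_pMr// ltr1n.
exists (x - h); first by apply/andP; split; lra.
have : `|0 - (- h)| < e by rewrite sub0r opprK gtr0_norm.
move=> /He /(_ _); rewrite oppr_eq0 gt_eqF// => /(_ isT).
rewrite /= -[- h *: 1]/(- h * 1) mulr1 [- h + x]addrC -[_ *: _]/(_ * _).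
by rewrite invrN mulNr oppr_lt0 pmulr_rgt0 ?invr_gt0// subr_gt0.
Qed.

Lemma is_derive_coord (R : realType) (m n : nat) (M : R -> 'M[R]_(m, n))
    (t : R) (D : 'M[R]_(m, n)) (i : 'I_m) (j : 'I_n) :
  is_derive t (1 : R) M D -> is_derive t (1 : R) (fun y => M y i j) (D i j).
Proof.
move=> [dM <-]; rewrite derive_mx// mxE.
by apply: derivableP; move/derivable_mxP : dM; exact.
Qed.

(* At a maximum over time and coordinates of the squares of the rescaled
   coordinates, weighted diagonal dominance makes the derivative negative, so
   this maximum can only be attained at the initial time. *)
Lemma weighted_dominance_decay (R : realType) (d : nat) (A : R -> 'M[R]_d)
    (w : 'I_d -> R) (g g' a : R) (x : R -> 'cV[R]_d) :
  (forall s, 0 < w s) -> g' < g ->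
  (forall t s, a <= t -> A t s s * w s +
     \sum_(r < d | r != s) `|A t s r| * w r <= - g * w s) ->
  (forall t, a <= t -> is_derive t (1 : R) x (A t *m x t)) ->
  (forall s, `|x a s ord0| <= w s) ->
  forall t s, a <= t -> `|x t s ord0| <= w s * expR (- g' * (t - a)).
Proof.
move=> w0 gg' dom dx xa T s0 aT.
(* The factor [E] cancels the expected decay, so the claim becomes [v s T <= 1]. Squares replace
   absolute values to stay differentiable at zeros. *)
pose E t : R := expR (g' * (t - a)).
pose u s t : R := (w s)^-1 * (x t s ord0 * E t).
pose v s t : R := u s t ^+ 2.
have dE t : is_derive t (1 : R) E (g' * E t).
  have h : is_derive t (1 : R) (fun y : R => g' * (y - a)) g'.
    have h : is_derive t (1 : R) (g' \*: (id - cst a) : R -> R) (g' *: (1 - 0)).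
      exact: is_deriveZ.
    by apply: (is_derive_eq h); rewrite subr0 -[_ *: _]/(_ * _) mulr1.
  by rewrite mulrC; exact: is_derive1_comp.
have du s t : a <= t -> is_derive t (1 : R) (u s)
    ((w s)^-1 * (\sum_r A t s r * w r * u r t) + g' * u s t).
  move=> /dx /(@is_derive_coord _ _ _ _ _ _ s ord0) dxs.
  apply: (is_derive_eq
    (is_deriveZ (w s)^-1 (is_deriveM dxs (dE t)))).
  rewrite /u -[_ *: _]/(_ * _) -[x t s ord0 *: _]/(_ * _) -[E t *: _]/(_ * _).
  have -> : \sum_r A t s r * w r * ((w r)^-1 * (x t r ord0 * E t)) =
            (A t *m x t) s ord0 * E t.
    rewrite mxE mulr_suml; apply: eq_bigr => r _.
    by have := gt_eqF (w0 r) => /negbT ?; field.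
  by ring.
have dv s t : a <= t -> is_derive t (1 : R) (v s)
    (2 * ((w s)^-1 * (\sum_r A t s r * w r * (u r t * u s t)) + g' * v s t)).
  move=> /(du s) dus.
  apply: (is_derive_eq (is_deriveX 2 dus)).
  rewrite /= -[_ *: _]/(_ * _) /v expr1.
  under [in RHS]eq_bigr => r _ do rewrite mulrA.
  by rewrite -mulr_suml; ring.
have ev s : exists2 c, c \in `[a, T]%R & forall t, t \in `[a, T]%R -> v s t <= v s c.
  apply: EVT_max => //; apply: derivable_within_continuous => t.
  by rewrite in_itv/= => /andP[/(dv s) ? _].
pose c s := s2val (cid2 (ev s)).
have c1 s : c s \in `[a, T]%R by exact: (s2valP (cid2 (ev s))).
have c2 s t : t \in `[a, T]%R -> v s t <= v s (c s).
  exact: (s2valP' (cid2 (ev s))).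
(* The coordinate [s0] witnesses that the index set is nonempty, which the maximum requires. *)
pose s := [arg max_(i > s0) v i (c i)]%O.
have smax r t : t \in `[a, T]%R -> v r t <= v s (c s).
  move=> tT; apply: (le_trans (c2 _ _ tT)).
  by rewrite /s; case: arg_maxP => // i _; exact.
have va r : v r a <= 1.
  rewrite /v /u /E subrr mulr0 expR0 mulr1 -real_normK ?num_real//.
  rewrite expr_le1// normrM gtr0_norm ?invr_gt0//.
  by rewrite ler_pdivrMl// mulr1.
(* A maximum above 1 cannot sit at time [a], so there is room to its left; a negative derivative
   there would give a larger earlier value. *)
have v1 : v s (c s) <= 1.
  rewrite leNgt; apply/negP => v1.
  have := c1 s; rewrite in_itv/= => /andP[ac cT].
  have {}ac : a < c s.
    rewrite lt_neqAle ac andbT; apply/eqP => ac'.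
    by move: v1; rewrite -ac' ltNge va.
  have neg : 2 * ((w s)^-1 *
      (\sum_r A (c s) s r * w r * (u r (c s) * u s (c s))) + g' * v s (c s)) < 0.
    rewrite pmulr_rlt0//.
    (* Maximality over the coordinates gives [|u r * u s| <= u s ^+ 2] at time [c s], so the
       dominance of row [s] bounds the whole sum. *)
    have le : \sum_r A (c s) s r * w r * (u r (c s) * u s (c s)) <=
        - g * w s * v s (c s).
      rewrite (le_trans _ (ler_wpM2r (sqr_ge0 _) (dom (c s) s (ltW ac))))//.
      rewrite (bigD1 s)//= mulrDl -expr2 lerD2l mulr_suml ler_sum// => r _.
      rewrite (le_trans (ler_norm _))// 2!normrM.
      rewrite (gtr0_norm (w0 r)) [`|u r _ * _|]normrM.
      apply: ler_wpM2l; first by rewrite mulr_ge0// ltW.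
      rewrite -[u s _ ^+ 2]real_normK ?num_real// expr2.
      apply: ler_wpM2r => //.
      rewrite -(@ler_pXn2r _ 2)// ?nnegrE// !real_normK ?num_real//.
      exact: smax (c1 s).
    rewrite -(ler_pM2l (_ : 0 < (w s)^-1)) ?invr_gt0// in le.
    have E1 : (w s)^-1 * (- g * w s * v s (c s)) = - g * v s (c s).
      by have := gt_eqF (w0 s) => /negbT ?; field.
    have : (g' - g) * v s (c s) < 0.
      by rewrite nmulr_rlt0 ?subr_lt0// (lt_trans _ v1).
    rewrite E1 in le; lra.
  have [y /andP[ay yc]] := is_derive_lt0_left (dv s _ (ltW ac)) neg ac.
  by apply/negP; rewrite -leNgt; apply: smax; rewrite in_itv/= ay (le_trans yc).
have : v s0 T <= 1 by rewrite (le_trans (smax _ _ _)) ?in_itv/= ?aT ?lexx.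
rewrite /v -real_normK ?num_real// expr_le1// /u !normrM (gtr0_norm (expR_gt0 _)).
rewrite normfV (gtr0_norm (w0 s0)) ler_pdivrMl// mulr1.
by rewrite -ler_pdivlMr ?expR_gt0// -expRN mulNr.
Qed.

Lemma matrix_norm0 (R : realType) (d : nat) (N : 'M[R]_d -> R)
    (hN : is_matrix_norm N) : N 0 = 0.
Proof. by rewrite -(scale0r 0) (matrix_normZ hN) normr0 mul0r. Qed.

(** Apply the triangle inequality to [A - A]: it gives [0 <= 2 * N A]. *)
Lemma matrix_norm_ge0 (R : realType) (d : nat) (N : 'M[R]_d -> R)
    (hN : is_matrix_norm N) (A : 'M[R]_d) : 0 <= N A.
Proof.
have N0 := matrix_norm0 hN.
have := matrix_normD hN A (- A).
rewrite subrr N0 -[in N (- A)]scaleN1r (matrix_normZ hN) normrN1 mul1r.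
by rewrite -mulr2n pmulrn_lge0.
Qed.

(** One half of the equivalence of norms, by expansion in matrix units. It reduces the theorem for
    an arbitrary norm to entrywise estimates. *)
Lemma matrix_norm_le_entries (R : realType) (d : nat) (N : 'M[R]_d -> R)
    (hN : is_matrix_norm N) (c : R) (A : 'M[R]_d) :
  (forall i j, `|A i j| <= c) ->
  N A <= c * \sum_i \sum_j N (delta_mx i j).
Proof.
move=> Ac.
have N0 := matrix_norm0 hN.
have sub I (r : seq I) (F : I -> 'M[R]_d) :
    N (\sum_(i <- r) F i) <= \sum_(i <- r) N (F i).
  elim: r => [|i r IH]; first by rewrite !big_nil N0.
  by rewrite !big_cons (le_trans (matrix_normD hN _ _))// lerD2l.
rewrite [in N A](matrix_sum_delta A) (le_trans (sub _ _ _))// mulr_sumr ler_sum// => i _.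
rewrite (le_trans (sub _ _ _))// mulr_sumr ler_sum// => j _.
by rewrite (matrix_normZ hN) ler_wpM2r// matrix_norm_ge0.
Qed.

Lemma mx_entry_le_norm (R : realType) (m n : nat) (A : 'M[R]_(m, n)) i j :
  `|A i j| <= `|A|.
Proof.
rewrite [leRHS]/Num.Def.normr/= mx_normrE.
by apply: (le_trans _ (le_bigmax _ _ (i, j))).
Qed.

Lemma bounded_blocks (R : realType) (m : nat) (dd : 'I_m -> nat) (I : set R)
    (Bb : forall i j : 'I_m, R -> 'M[R]_(dd i, dd j)) :
  (forall i j : 'I_m, (j <= i)%N -> [bounded Bb i j t | t in I]) ->
  exists2 C : R, 0 <= C & forall (i j : 'I_m) t k l,
    (j <= i)%N -> I t -> `|Bb i j t k l| <= C.
Proof.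
move=> bB.
have H (p : 'I_m * 'I_m) : exists C : R, 0 <= C /\ ((p.2 <= p.1)%N ->
    forall t, I t -> `|Bb p.1 p.2 t| <= C).
  have [/bB bp|_] := leqP p.2 p.1; last by exists 0.
  have [C C0 HC] := pinfty_ex_gt0 bp.
  by exists C; split=> [|_ t It]; [exact: ltW|exact: HC].
have [C HC] := choice H.
(* All the constants are nonnegative, so their sum dominates each of them. *)
exists (\sum_p C p); first by apply: sumr_ge0 => p _; have [] := HC p.
move=> i j t k l ji It.
rewrite (le_trans (mx_entry_le_norm _ _ _))// (bigD1 (i, j))//=.
have [_ /(_ ji t It) h] := HC (i, j).
by rewrite (le_trans h)// lerDl; apply: sumr_ge0 => p _; have [] := HC p.
Qed.

(** In block row [n], a column of an earlier block has weight at most [L ^+ n / L]. Hence all these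
    columns together contribute at most [C * (\sum_i dd i) / L <= delta / 2] times [L ^+ n], which
    leaves half of the margin of the diagonal block. *)
Lemma block_triangular_dominance (R : realType) (m : nat) (dd : 'I_m -> nat)
    (Bb : forall i j : 'I_m, 'M[R]_(dd i, dd j)) (C L delta : R) :
  (forall (i j : 'I_m) k l, (j <= i)%N -> `|Bb i j k l| <= C) ->
  0 <= C -> 1 <= L -> 2 * (C * (\sum_(i < m) dd i)%:R) <= delta * L ->
  (forall (n : 'I_m) (i j : 'I_(dd n)), i != j -> 0 <= Bb n n i j) ->
  (forall (n : 'I_m) (i : 'I_(dd n)), \sum_j Bb n n i j <= - delta) ->
  let A : 'M[R]_(\sum_(i < m) dd i) :=
    \mxblock_(i, j) (if (j <= i)%N then Bb i j else 0) in
  let w (s : 'I_(\sum_(i < m) dd i)) := L ^+ tagnat.sig1 s in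
  forall s, A s s * w s + \sum_(r | r != s) `|A s r| * w r <=
    - (delta / 2) * w s.
Proof.
move=> BC C0 L1 CL off row A w s.
have L0 : 0 < L by rewrite (lt_le_trans _ L1).
pose T := {i : 'I_m & 'I_(dd i)}.
pose e (p q : T) : R :=
  (if (tag q <= tag p)%N then Bb (tag p) (tag q) else 0) (tagged p) (tagged q).
have AE r t : A r t = e (tagnat.sig r) (tagnat.sig t) by rewrite mxE.
(* Treating the diagonal entry and the absolute values as one summand lets the row sum be split by
   blocks. *)
pose F (p q : T) := (if q == p then e p q else `|e p q|) * L ^+ tag q.
have -> : A s s * w s + \sum_(r | r != s) `|A s r| * w r =
    \sum_r F (tagnat.sig s) (tagnat.sig r).
  rewrite [RHS](bigD1 s)//= {1}/F eqxx -AE; congr (_ + _).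
  apply: eq_bigr => r rs.
  by rewrite /F (inj_eq tagnat.sig_inj) (negbTE rs) -AE.
rewrite -(reindex _ tagnat.sig_bij_on (P := xpredT)) /=.
have -> : w s = L ^+ tag (tagnat.sig s) by [].
case: (tagnat.sig s) => n i {w A AE s} /=.
rewrite -(sig_big_dep xpredT (fun _ => xpredT) (fun k j => F (Tagged _ i) (Tagged (fun i => 'I_(dd i)) j))) /=.
rewrite (bigD1 n)//=.
have Ln : 0 <= L ^+ n by rewrite exprn_ge0// ltW.
have diag : \sum_(j < dd n) F (Tagged (fun i => 'I_(dd i)) i)
    (Tagged (fun i => 'I_(dd i)) j) <= - delta * L ^+ n.
  rewrite (le_trans _ (ler_wpM2r Ln (row n i)))// mulr_suml ler_sum// => j _.
  rewrite /F /e /= leqnn eq_Tagged /=; case: eqVneq => // ji.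
  by rewrite ger0_norm// off// eq_sym.
(* The bound deliberately counts every block, including [k = n] and the zero blocks [k > n].
   Dividing by [L] avoids the exponent [n - 1], which would be truncated at [n = 0]. *)
have rest : \sum_(k | k != n) \sum_(j < dd k)
    F (Tagged (fun i => 'I_(dd i)) i) (Tagged (fun i => 'I_(dd i)) j) <=
    \sum_(k < m) (dd k)%:R * (C * (L ^+ n / L)).
  rewrite big_mkcond ler_sum// => k _; case: ifPn => [kn|_]; last first.
    by rewrite !mulr_ge0// invr_ge0 ltW.
  rewrite (@le_trans _ _ (\sum_(j < dd k) C * (L ^+ n / L)))//; last first.
    by rewrite sumr_const card_ord mulr_natl.
  apply: ler_sum => j _; rewrite /F.
  case: eqP => [/(congr1 tag)/= kn'|_]; first by rewrite kn' eqxx in kn.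
  rewrite /e /=; case: leqP => [kn1|_]; last first.
    by rewrite mxE normr0 mul0r !mulr_ge0// invr_ge0 ltW.
  have {}kn : (k < n)%N by rewrite ltn_neqAle kn1 andbT.
  rewrite ler_pM ?exprn_ge0 ?(ltW L0)//; first exact: BC.
  by rewrite ler_pdivlMr// -exprSr ler_weXn2l.
rewrite (le_trans (lerD diag rest))// -mulr_suml -natr_sum.
have : C * (\sum_(k < m) dd k)%:R / L <= delta / 2.
  by rewrite ler_pdivrMr//; lra.
move=> /(ler_wpM2r Ln); lra.
Qed.

Theorem theorem1 (R : realType) (tau : \bar R) (htau : (tau < +oo)%E)
    (m : nat) (hm : (1 <= m)%N)
    (dd : 'I_m -> nat) (hdd : forall i : 'I_m, (0 < dd i)%N)
    (N : 'M[R]_(\sum_(i < m) dd i) -> R) (hN : is_matrix_norm N)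
    (B : R -> 'M[R]_(\sum_(i < m) dd i))
    (hBcont : {within open_ray tau, continuous B})
    (Phi : R -> R -> 'M[R]_(\sum_(i < m) dd i))
    (hPhi : is_transition_operator (open_ray tau) B Phi)
    (Bb : forall i j : 'I_m, R -> 'M[R]_(dd i, dd j))
    (hBblock : forall t : R, open_ray tau t ->
       B t = \mxblock_(i < m, j < m) (if (j <= i)%N then Bb i j t else 0))
    (hBbounded : forall i j : 'I_m, (j <= i)%N ->
       [bounded Bb i j t | t in open_ray tau])
    (delta : R) (hdelta : 0 < delta)
    (hneg : forall (n : 'I_m) (t : R) (i : 'I_(dd n)),
       open_ray tau t -> Bb n n t i i < 0)
    (hoff : forall (n : 'I_m) (t : R) (i j : 'I_(dd n)),
       open_ray tau t -> i != j -> 0 <= Bb n n t i j)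
    (hrow : forall (n : 'I_m) (t : R) (i : 'I_(dd n)),
       open_ray tau t -> \sum_(j < dd n) Bb n n t i j <= - delta) :
  exponentially_stable (open_ray tau) N Phi.
Proof.
have [C C0 HC] := bounded_blocks hBbounded.
(* With this choice [delta * L] equals [delta] plus the required lower bound. *)
pose L : R := 1 + 2 * (C * (\sum_(i < m) dd i)%:R) / delta.
have L1 : 1 <= L by rewrite lerDl !mulr_ge0// invr_ge0 ltW.
have CL : 2 * (C * (\sum_(i < m) dd i)%:R) <= delta * L.
  by rewrite /L mulrDr mulr1 [delta * (_ / _)]mulrC divfK ?gt_eqF// lerDr ltW.
pose w (s : 'I_(\sum_(i < m) dd i)) : R := L ^+ tagnat.sig1 s.
have w1 s : 1 <= w s by rewrite exprn_ege1.
pose S := \sum_i \sum_j N (delta_mx i j).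
have S0 : 0 <= S.
  by apply: sumr_ge0 => i _; apply: sumr_ge0 => j _; exact: matrix_norm_ge0.
(* [L ^+ m] bounds all weights, [S] passes from entries to [N], and the summand 1 ensures [1 <= K].
   The rate [delta / 4] lies strictly below the dominance margin [delta / 2]. *)
exists (1 + L ^+ m * S), (delta / 4); split.
- by rewrite lerDl mulr_ge0// exprn_ge0// (le_trans _ L1).
- by rewrite divr_gt0.
move=> t t0 It0 tt0.
have Iy y : t0 <= y -> open_ray tau y.
  by move=> ty; apply: (lt_le_trans It0); rewrite lee_fin.
have ent i j : `|Phi t t0 i j| <= L ^+ m * expR (- (delta / 4) * (t - t0)).
  (* Column [j] of [Phi] is the solution starting at the unit vector [j], whose entries are at most
     1 and so below the weights. *)
  have [sol init] := hPhi t0 (delta_mx j (ord0 : 'I_1)) It0.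
  have := @weighted_dominance_decay R _ B w (delta / 2) (delta / 4) t0
    (fun y => Phi y t0 *m delta_mx j ord0).
  move=> /(_ _ _ _ _ _ t i tt0) h.
  have -> : Phi t t0 i j = (Phi t t0 *m delta_mx j (ord0 : 'I_1)) i ord0.
    by rewrite -colE mxE.
  rewrite (le_trans (h _ _ _ _ _))//.
  + by move=> s; rewrite (lt_le_trans _ (w1 s)).
  + by rewrite ltr_pM2l// ltf_pV2 ?posrE// ltr_nat.
  + move=> y s ty; rewrite hBblock; last exact: Iy.
    apply: (@block_triangular_dominance _ _ _ (fun i j => Bb i j y) C) => //.
    * by move=> k l p q lk; apply: HC => //; exact: Iy.
    * by move=> n k l; apply: hoff; exact: Iy.
    * by move=> n k; apply: hrow; exact: Iy.
  + by move=> y ty; exact/sol/Iy.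
  + move=> s; rewrite init mxE (le_trans _ (w1 s))//.
    by case: (_ && _); rewrite ?normr1 ?normr0.
  + by rewrite ler_wpM2r ?expR_ge0// ler_weXn2l// ltnW.
rewrite (le_trans (matrix_norm_le_entries hN ent))//.
by rewrite -mulrA [expR _ * _]mulrC mulrA ler_wpM2r ?expR_ge0// lerDr.
Qed.
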